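(* For every large $n$ there is a set $E$ of $n$ points in $\mathbb{R}^5$ such that the number of tuples $(x_1,x_2,x_3,x_4)\in E^4$ with $\angle(x_1,x_2,x_3)=\angle(x_2,x_3,x_4)=\pi/2$ is $\approx n^4$.
   Context: $\angle(x,y,z)\in[0,\pi]$ denotes the angle at $y$ between $x-y$ and $z-y$ (for $x\ne y\ne z$). $X\approx Y$ means $c Y\le X\le CY$ for all $n>N$ with positive constants $c,C,N$ independent of $n$. *)

(* Defs.v *)
From mathcomp Require Import all_boot all_order all_algebra.
From mathcomp Require Import finmap.
From mathcomp Require Import reals trigo.

Set Implicit Arguments.
Unset Strict Implicit.
Unset Printing Implicit Defensive.

Import Order.TTheory GRing.Theory Num.Theory.
Local Open Scope ring_scope.

Definition dot (R : realType) (d : nat) (u v : 'rV[R]_d) : R :=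
  \sum_(i < d) u 0 i * v 0 i.

(* The norm [`|u|] that MathComp-Analysis puts on row vectors is the sup norm,
   hence a separate Euclidean norm. *)
Definition enorm (R : realType) (d : nat) (u : 'rV[R]_d) : R :=
  Num.sqrt (dot u u).

(* Meaningful only if [x != y] and [y != z]. Since [a / 0 = 0], in the
   degenerate cases the value is [acos 0 = pi / 2], so every use of [angle]
   has to come with these two conditions. *)
Definition angle (R : realType) (d : nat) (x y z : 'rV[R]_d) : R :=
  acos (dot (x - y) (z - y) / (enorm (x - y) * enorm (z - y))).

Definition has_angle (R : realType) (d : nat) (a : R) (x y z : 'rV[R]_d) :
    bool :=
  [&& x != y, y != z & angle x y z == a].

Definition num_angle_chains (R : realType) (d : nat) (a b : R)
    (E : {fset 'rV[R]_d}) : nat :=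
  #|[pred t : E * E * E * E |
      let: (x1, x2, x3, x4) := t in
      has_angle a (fsval x1) (fsval x2) (fsval x3) &&
      has_angle b (fsval x2) (fsval x3) (fsval x4)]|.

(* Main.v *)
Require Import Defs.
From mathcomp Require Import all_boot all_order all_algebra.
From mathcomp Require Import finmap.
From mathcomp Require Import reals trigo.
From mathcomp Require Import zify ring.

Import Order.TTheory GRing.Theory Num.Theory.
Local Open Scope ring_scope.

(** Write R^5 = R^2 + R^2 + R, put p = (1, 0), q = (0, 0) and let c(t) run over
the circle with diameter [p, q]. The chains are x1 = (p, p, s), x2 = (c(t), p, 0),
x3 = (q, c(u), 0), x4 = (q, q, v). Both scalar products vanish blockwise: in each
block either one of the two factors is zero or the vertex of the angle lies on
the circle over [p, q] (Thales). Hence the four parameters are independent, and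
taking a quarter of the points of each kind gives about (n/4)^4 chains. *)

Lemma has_right_angle (R : realType) (d : nat) (x y z : 'rV[R]_d) :
  x != y -> y != z -> dot (x - y) (z - y) = 0 -> has_angle (pi / 2) x y z.
Proof.
by move=> xy yz dot0; rewrite /has_angle xy yz /angle dot0 mul0r acos0 eqxx.
Qed.

(** The four families may overlap: a tuple records which entry comes from which family, so the
    product map [h] is injective as soon as each factor is. *)
Lemma leq_num_angle_chains (R : realType) (d m : nat) (a b : R)
    (E : {fset 'rV[R]_d}) (h1 h2 h3 h4 : 'I_m -> E) :
  injective h1 -> injective h2 -> injective h3 -> injective h4 ->
  (forall i j k l,
    has_angle a (fsval (h1 i)) (fsval (h2 j)) (fsval (h3 k)) &&
    has_angle b (fsval (h2 j)) (fsval (h3 k)) (fsval (h4 l))) ->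
  (m ^ 4 <= num_angle_chains a b E)%N.
Proof.
move=> inj1 inj2 inj3 inj4 chain.
pose h (t : 'I_m * 'I_m * 'I_m * 'I_m) :=
  let: (i, j, k, l) := t in (h1 i, h2 j, h3 k, h4 l).
have h_inj : injective h.
  move=> [[[i j] k] l] [[[i' j'] k'] l'] [].
  by move=> /inj1 -> /inj2 -> /inj3 -> /inj4 ->.
have -> : (m ^ 4 = #|{: 'I_m * 'I_m * 'I_m * 'I_m}|)%N.
  by rewrite !card_prod card_ord !expnS expn0; lia.
rewrite -(card_codom h_inj); apply: subset_leq_card.
by apply/subsetP => _ /codomP[[[[i j] k] l] ->]; rewrite inE; apply: chain.
Qed.

Lemma num_angle_chains_leq (R : realType) (d : nat) (a b : R)
    (E : {fset 'rV[R]_d}) :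
  (num_angle_chains a b E <= #|` E| ^ 4)%N.
Proof.
apply: leq_trans (max_card _) _.
by rewrite !card_prod -cardfE !expnS expn0; lia.
Qed.

(** The point c(t) = (1 / (1 + t^2), t / (1 + t^2)) is where the line of slope t through q meets the
    circle x^2 + y^2 = x again. *)
Definition thales_coord (R : realType) (r : nat) (t : R) : seq R :=
  match r with
  | 0 => [:: 1; 0; 1; 0; t]
  | 1 => [:: (1 + t ^+ 2)^-1; t / (1 + t ^+ 2); 1; 0; 0]
  | 2 => [:: 0; 0; (1 + t ^+ 2)^-1; t / (1 + t ^+ 2); 0]
  | _ => [:: 0; 0; 0; 0; t]
  end.

Definition thales_pt (R : realType) (r : nat) (t : R) : 'rV[R]_5 :=
  \row_i (thales_coord R r t)`_i.

Lemma one_sqr_neq0 (R : realType) (t : R) : 1 + t ^+ 2 != 0.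
Proof. by rewrite gt_eqF // ltr_wpDr ?sqr_ge0. Qed.

(* Thanks to x / 0 = 0, one formula recovers the parameter for all four kinds. *)
Definition thales_param (R : realType) (x : 'rV[R]_5) : R :=
  x 0 (inord 4) + x 0 (inord 1) / x 0 (inord 0)
    + x 0 (inord 3) / x 0 (inord 2).

Lemma thales_ptK (R : realType) (r : nat) : cancel (thales_pt R r) (@thales_param R).
Proof.
move=> t; have t0 := one_sqr_neq0 R t.
by rewrite /thales_param !mxE !inordK //; case: r => [|[|[|r]]] /=;
  rewrite ?invr0 ?invr1; field.
Qed.

Lemma thales_chain (R : realType) (s t u v : R) :
  t != 0 -> u != 0 ->
  has_angle (pi / 2) (thales_pt R 0 s) (thales_pt R 1 t) (thales_pt R 2 u) &&
  has_angle (pi / 2) (thales_pt R 1 t) (thales_pt R 2 u) (thales_pt R 3 v).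
Proof.
move=> t0 u0; have t1 := one_sqr_neq0 R t; have u1 := one_sqr_neq0 R u.
have neq (x y : 'rV[R]_5) k : x 0 k != y 0 k -> x != y.
  by apply: contraNneq => ->.
(* For a nonzero parameter, c lies off the line through p and q, so its second coordinate separates
   it from both. *)
have x12 : thales_pt R 0 s != thales_pt R 1 t.
  by apply: (neq _ _ (inord 1)); rewrite !mxE inordK //= eq_sym mulf_neq0 ?invr_eq0.
have x23 : thales_pt R 1 t != thales_pt R 2 u.
  by apply: (neq _ _ (inord 1)); rewrite !mxE inordK //= mulf_neq0 ?invr_eq0.
have x34 : thales_pt R 2 u != thales_pt R 3 v.
  by apply: (neq _ _ (inord 3)); rewrite !mxE inordK //= mulf_neq0 ?invr_eq0.
by apply/andP; split; apply: has_right_angle => //;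
  rewrite /dot !big_ord_recl big_ord0 !mxE /=; field; rewrite ?t1 ?u1.
Qed.

(** The kinds are interleaved so that every initial segment has about a quarter of its points of
    each kind. The parameter [k.+1] is nonzero, and it never repeats, so points of different kinds
    are distinct too. *)
Definition thales_seq (R : realType) (k : nat) : 'rV[R]_5 :=
  thales_pt R (k %% 4) k.+1%:R.

Lemma thales_seq_inj (R : realType) : injective (thales_seq R).
Proof.
move=> k l /(congr1 (@thales_param R)); rewrite !thales_ptK.
by move/eqP; rewrite eqr_nat eqSS => /eqP.
Qed.

Theorem theorem5p1 (R : realType) :
  exists (c C : R) (N : nat),
    [/\ 0 < c, 0 < C, (0 < N)%N &
      forall n : nat, (N < n)%N ->
        exists E : {fset 'rV[R]_5},
          #|` E| = n /\
          c * n%:R ^+ 4 <= (num_angle_chains (pi / 2) (pi / 2) E)%:R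
                        <= C * n%:R ^+ 4].
Proof.
(* [C] = 1 comes from counting all quadruples, [c] from m^4 chains with n <= 8m. *)
exists (8 ^- 4), 1, 4%N; split; rewrite ?invr_gt0 ?exprn_gt0 // => n n_gt4.
pose E := [fset thales_seq R (val i) | i in 'I_n]%fset.
have cardE : #|` E| = n.
  rewrite card_imfset /=; first by rewrite size_enum_ord.
  by move=> i j /thales_seq_inj /val_inj.
exists E; split => //; apply/andP; split; last first.
  by rewrite mul1r -natrX ler_nat -cardE num_angle_chains_leq.
pose m := (n %/ 4)%N.
have ltn_idx r (i : 'I_m) : (r < 4)%N -> (i * 4 + r < n)%N.
  by have := ltn_ord i; rewrite /m; lia.
have inE4 r (r4 : (r < 4)%N) (i : 'I_m) : thales_seq R (i * 4 + r) \in E.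
  by apply/imfsetP; exists (Ordinal (ltn_idx r i r4)).
pose h r (r4 : (r < 4)%N) i : E := [` inE4 r r4 i]%fset.
have h_inj r r4 : injective (h r r4).
  move=> i j /(congr1 (@fsval _ _)) /thales_seq_inj /= ij.
  by apply: val_inj => /=; lia.
have m4 : (m ^ 4 <= num_angle_chains (pi / 2) (pi / 2) E)%N.
  apply: (@leq_num_angle_chains _ _ _ _ _ _ (h 0 isT) (h 1 isT) (h 2 isT) (h 3 isT))
    => // i j k l.
  by rewrite /= /thales_seq !modnMDl; apply: thales_chain; rewrite pnatr_eq0.
(* Since m >= 1, rounding down costs at most a factor 2: n < 4(m + 1) <= 8m. *)
have n8m : (n <= 8 * m)%N by rewrite /m; lia.
rewrite mulrC ler_pdivrMr ?exprn_gt0 // -!natrX -natrM ler_nat.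
apply: leq_trans (leq_mul m4 (leqnn _)).
by rewrite -expnMn mulnC leq_exp2r.
Qed.
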